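(* Let $V\in Gr_{k,n}$, let $D$ be the Go-diagram (in a partition $\lambda\in\Lambda_{k,n}$) such that $V\in\mathcal D_D$, and let $\{\beta_b\}_{b\in\lambda}$ be the jump parameters (with $\beta_b\in\mathbb F$ if $D(b)=\bullet$, $\beta_b\in\mathbb F^*$ if $D(b)=+$, $\beta_b=0$ if $D(b)=\circ$) for the restricted path matrix $R_D$ which realizes $V$ in the standard basis of $\mathbb F^n$. If we set $\beta_b^\star=-\beta_b$ for all $b\in\lambda$, then the dual restricted path matrix $R_D^\star$ realizes $V^\star=\{f\in(\mathbb F^n)^\star : f(v)=0\text{ for all }v\in V\}$ in the basis dual to the standard basis.
   Context: **Partitions and pipe dreams.** Let $k\le n$ be natural numbers. $\Lambda_{k,n}$ is the set of partitions $\lambda=(\lambda_1\ge\dots\ge\lambda_k\ge 0)$ with $\lambda_1\le n-k$; $\lambda$ is identified with its Young diagram (English notation) in the top-left corner of a rectangle with $k$ rows and $n-k$ columns. The south-east border of $\lambda$ is the lattice path from the north-east corner to the south-west corner of the rectangle bounding $\lambda$; its $n$ unit edges are labelled $1,\dots,n$ starting from the north-east end. The north-west border consists of the top side of the rectangle ($n-k$ edges, the north boundary) and its left side ($k$ edges, the west boundary). A pipe dream on $\lambda$ is a filling of every cell by a crossing tile or an elbow tile. Pipe $j$ starts at the south-east border edge labelled $j$ and travels to the north-west border: it enters each cell through its east or south edge; in a crossing tile east continues to west and south continues to north; in an elbow tile east turns to north and south turns to west. Each edge of the north-west border is labelled by the index of the pipe exiting there. Given a pipe dream, write $+$ in each elbow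 cell; in a crossing cell write $\circ$ (white stone) if the pipe entering from the east has the smaller index of the two pipes, and $\bullet$ (black stone) if the pipe entering from the east has the larger index. A pipe dream is a Go-diagram if in no elbow cell the pipe entering from the east has larger index than the pipe entering from the south. $D(b)$ denotes the symbol at cell $b$. **Restricted paths and dual restricted paths.** Vertices are attached to all labels on the two borders; those on the north-west border are sources, those on the south-east border are sinks. A restricted path (resp. dual restricted path) goes from a source to a sink along the pipes (traversed from the north-west border towards the south-east border), following the pipe it is on, except that upon entering a cell with $+$ or $\bullet$ it may alternatively jump to the other pipe of that cell provided that pipe has the lower (resp. higher) index. A cell where it changes pipes is a jump site. Jump parameters $\beta_b$ (resp. $\beta_b^\star$) are attached to the cells $b$; the weight of a path is the product of the parameters $\beta_b$ (resp. $\beta_b^\star$) at its jump sites. $(\tilde R_D)_{st}$ (resp. $(\tilde R^\star_D)_{st}$) is the sum of the weights of all restricted (resp. dual restricted) paths from the source labelled $s$ to the sink labelled $t$. If $v_1,\dots,v_k$ are the labels on the west boundary from top to bottom, $R_D$ is the $k\times n$ matrix $(R_D)_{st}=(\tilde R_D)_{v_st}$. If $u_1,\dots,u_{n-k}$ are the labels on the north boundary from right to left, $R_D^\star$ is the $(n-k)\times n$ matrix $(R_D^\star)_{st}=(\tilde R_D^\star)_{u_st}$. **Deodhar components.** $\mathbb F$ is $\mathbb R$ or $\mathbb C$, $\mathbb F^*=\mathbb F\setminus\{0\}$, while $(\mathbb F^n)^\star$ is the dual vector space. $Gr_{k,n}$ is the Grassmannian of $k$-dimensional subspaces of $\mathbb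 F^n$; a matrix realizes a subspace in a given basis if its rows are the coordinate vectors of a basis of the subspace. For $1\le i\le n-1$ let $\phi_i:SL_2(\mathbb F)\to SL_n(\mathbb F)$ embed $\begin{pmatrix}a&b\\c&d\end{pmatrix}$ as the diagonal block in rows and columns $n-i,\,n-i+1$, identity elsewhere. Put $x_i(p)=\phi_i\begin{pmatrix}1&p\\0&1\end{pmatrix}$, $y_i(p)=\phi_i\begin{pmatrix}1&0\\ p&1\end{pmatrix}$, $\dot s_i=\phi_i\begin{pmatrix}0&-1\\1&0\end{pmatrix}$. Attach to the cell in row $r$, column $c$ of $\lambda$ the index $n-k+r-c$. A reading word on $\lambda$ is a bijective filling of the cells with $1,\dots,m$ ($m=|\lambda|$) decreasing left to right in rows and top to bottom in columns. Fix one, let $b_l$ be the cell with entry $l$ and $i_l$ the index attached to it. Let $G_D$ be the set of products $g=g_1g_2\cdots g_m$ with $g_l=x_{i_l}(q_l)\dot s_{i_l}^{-1}$, $q_l\in\mathbb F$, if $D(b_l)=\bullet$; $g_l=y_{i_l}(p_l)$, $p_l\in\mathbb F^*$, if $D(b_l)=+$; $g_l=\dot s_{i_l}$ if $D(b_l)=\circ$. The Deodhar component $\mathcal D_D\subset Gr_{k,n}$ is the set of row spans of the $k\times n$ matrices $A$ with $A_{r,j}=g_{n+1-j,\,r}$, $g\in G_D$; it does not depend on the reading word, and $Gr_{k,n}$ is the disjoint union of the $\mathcal D_D$ over all Go-diagrams $D$ in partitions $\lambda\in\Lambda_{k,n}$. Each point of $\mathcal D_D$ is realized by $R_D$ for a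 unique choice of jump parameters with $\beta_b\in\mathbb F$ at $\bullet$, $\beta_b\in\mathbb F^*$ at $+$, $\beta_b=0$ at $\circ$. *)

(* Defs.v *)
From HB Require Import structures.
From mathcomp Require Import all_boot all_order all_algebra.
From mathcomp Require Import reals.
From mathcomp.real_closed Require Import complex.

Set Implicit Arguments.
Unset Strict Implicit.
Unset Printing Implicit Defensive.

Import GRing.Theory.

(** Rows, columns, border labels and pipes are all numbered from 0, so pipe [j]
    here is pipe [j+1] in the usual 1-based convention. *)

Variant real_or_complex (R : realType) : fieldType -> Prop :=
  | IsReal : real_or_complex R R
  | IsComplex : real_or_complex R R[i].

Section PipeDreams.
Variables k n : nat.

Definition is_partition (lam : k.-tuple nat) : bool :=
  sorted geq lam && all (fun x => x <= n - k) lam.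

(** Positions (row, column).  The extra last row and column only serve to name
    the east and south sides of the cells (see [east] and [south]). *)
Definition pos : Type := ('I_k.+1 * 'I_(n - k).+1)%type.

(** [false] in row [k], where [nth] takes its default value. *)
Definition in_shape (lam : k.-tuple nat) (b : pos) : bool :=
  (b.2 < nth 0 lam b.1).

Variant tile := Crossing | Elbow.

(** Only the values on the cells of the partition are ever used. *)
Definition filling : Type := pos -> tile.

Variant side := West | North.

Definition bool_of_side s := if s is West then true else false.
Definition side_of_bool (x : bool) := if x then West else North.
Lemma bool_of_sideK : cancel bool_of_side side_of_bool.
Proof. by case. Qed.
HB.instance Definition _ := Finite.copy side (can_type bool_of_sideK).

(** [(West, b)] is the unit edge on the west side of position [b] and
    [(North, b)] the one on its north side. *)
Definition edge : Type := (side * pos)%type.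

Definition east (b : pos) : edge := (West, (b.1, inord b.2.+1)).
Definition south (b : pos) : edge := (North, (inord b.1.+1, b.2)).

Section Filled.
Variables (lam : k.-tuple nat) (D : filling).

Definition col_height (c : nat) : nat := count (fun x => c < x) lam.

Definition on_nw_border (e : edge) : bool :=
  match e with
  | (West, (r, c)) => (r < k) && (c == 0 :> nat)
  | (North, (r, c)) => (c < n - k) && (r == 0 :> nat)
  end.

Definition on_se_border (e : edge) : bool :=
  match e with
  | (West, (r, c)) => (r < k) && (c == nth 0 lam r :> nat)
  | (North, (r, c)) => (c < n - k) && (r == col_height c :> nat)
  end.

(** Number of steps that the lattice path from the north-east corner makes before
    the edge [e] of the south-east border: the vertical step of row [r] comes
    after [r] vertical and [n - k - lam_r] horizontal steps, the horizontal step
    of column [c] after [n - k - 1 - c] horizontal ones and as many vertical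
    ones as there are cells in that column. *)
Definition se_label (e : edge) : nat :=
  match e with
  | (West, (r, c)) => r + (n - k - nth 0 lam r)
  | (North, (r, c)) => (n - k - c.+1) + col_height c
  end.

(** The edge through which the pipe entering (from the north-west) a cell by its
    side [e] leaves that cell, and the edge through which its other pipe does. *)
Definition stay (e : edge) : edge :=
  match e.1, D e.2 with
  | West, Crossing | North, Elbow => east e.2
  | West, Elbow | North, Crossing => south e.2
  end.

Definition jump (e : edge) : edge :=
  match e.1, D e.2 with
  | West, Crossing | North, Elbow => south e.2
  | West, Elbow | North, Crossing => east e.2
  end.

(** Index of the pipe running along [e]: follow it back to the south-east border,
    which takes fewer than [n] steps since each one increases row + column. *)
Definition pipe (e : edge) : nat :=
  se_label (iter n (fun e' => if in_shape lam e'.2 then stay e' else e') e).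

Variant stone := Plus | White | Black.

Definition symbol (b : pos) : stone :=
  match D b with
  | Elbow => Plus
  | Crossing => if (pipe (east b) < pipe (south b)) then White else Black
  end.

Definition Go_diagram : Prop :=
  forall b, in_shape lam b -> D b = Elbow -> ~ (pipe (south b) < pipe (east b)).

(** Paths are sequences of edges from a source to a sink.  [better j i] says that
    a path on pipe [i] may jump to pipe [j]. *)
Section Paths.
Variable better : rel nat.

Definition may_jump (e : edge) : bool :=
  match symbol e.2 with
  | White => false
  | Plus | Black => better (pipe (jump e)) (pipe (stay e))
  end.

Definition path_step (e e' : edge) : bool :=
  in_shape lam e.2 && ((e' == stay e) || may_jump e && (e' == jump e)).

Definition is_path (s t : nat) (p : seq edge) : bool :=
  if p is e :: p' then
    [&& on_nw_border e, pipe e == s, path path_step e p',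
        on_se_border (last e p') & se_label (last e p') == t]
  else false.

End Paths.

Definition jump_sites (p : seq edge) : seq pos :=
  [seq x.1.2 | x <- zip p (behead p) & x.2 != stay x.1].

Local Open Scope ring_scope.

Variable F : fieldType.

Definition weight (beta : pos -> F) (p : seq edge) : F :=
  \prod_(b <- jump_sites p) beta b.

(** Row + column goes up by 1 along each step and is at most [n - 1] on the
    borders, so a path has at most [n] edges. *)
Definition path_sum (better : rel nat) (beta : pos -> F) (s t : nat) : F :=
  \sum_(p : n.-bseq edge | is_path better s t p) weight beta p.

Definition restricted_sum := path_sum ltn.
Definition dual_restricted_sum := path_sum gtn.

Definition west_label (i : 'I_k) : nat := pipe (West, (inord i, ord0)).

(** From right to left. *)
Definition north_label (i : 'I_(n - k)) : nat :=
  pipe (North, (ord0, inord (n - k - i.+1)%N)).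

Definition restricted_mx (beta : pos -> F) : 'M[F]_(k, n) :=
  \matrix_(i, t) restricted_sum beta (west_label i) t.

Definition dual_restricted_mx (beta : pos -> F) : 'M[F]_(n - k, n) :=
  \matrix_(i, t) dual_restricted_sum beta (north_label i) t.

Definition jump_parameters (beta : pos -> F) : Prop :=
  forall b, in_shape lam b ->
    match symbol b return Prop with
    | Black => True
    | Plus => beta b != 0
    | White => beta b = 0
    end.

(** A reading word is given as the list [b_1, ..., b_m] of the cells carrying the
    entries [1, ..., m]. *)
Definition reading_word (w : seq pos) : Prop :=
  [/\ uniq w, w =i in_shape lam,
      (forall b b', in_shape lam b -> in_shape lam b' ->
         b.1 = b'.1 -> (b.2 < b'.2)%N -> (index b' w < index b w)%N)
    & (forall b b', in_shape lam b -> in_shape lam b' ->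
         b.2 = b'.2 -> (b.1 < b'.1)%N -> (index b' w < index b w)%N)].

Definition mx2 (a b c d : F) : 'M[F]_2 :=
  \matrix_(u, v) if u == 0 then (if v == 0 then a else b)
                 else (if v == 0 then c else d).

(** Block in the 0-based rows and columns [n - i - 1] and [n - i]. *)
Definition phi (i : nat) (M : 'M[F]_2) : 'M[F]_n :=
  let lo := (n - i.+1)%N in
  let in_block (u : 'I_n) := (lo <= u <= lo.+1)%N in
  \matrix_(u, v) if in_block u && in_block v
                 then M (inord (u - lo)) (inord (v - lo)) else (u == v)%:R.

Definition xmx (i : nat) (q : F) := phi i (mx2 1 q 0 1).
Definition ymx (i : nat) (p : F) := phi i (mx2 1 0 p 1).
Definition sdot (i : nat) := phi i (mx2 0 (- 1) 1 0).

Definition cell_index (b : pos) : nat := (n - k + b.1 - b.2)%N.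

Definition factor (q : pos -> F) (b : pos) : 'M[F]_n :=
  let i := cell_index b in
  match symbol b with
  | Black => xmx i (q b) *m invmx (sdot i)
  | Plus => ymx i (q b)
  | White => sdot i
  end.

Definition in_GD (w : seq pos) (g : 'M[F]_n) : Prop :=
  exists q : pos -> F,
    (forall b, in_shape lam b -> symbol b = Plus -> q b != 0) /\
    g = \big[mulmx/1%:M]_(b <- w) factor q b.

Definition deodhar_mx (hkn : (k <= n)%N) (g : 'M[F]_n) : 'M[F]_(k, n) :=
  \matrix_(r, j) g (rev_ord j) (widen_ord hkn r).

Definition in_Deodhar (hkn : (k <= n)%N) (w : seq pos)
    (V : {vspace 'rV[F]_n}) : Prop :=
  exists2 g, in_GD w g &
    V = <<[seq row r (deodhar_mx hkn g) | r <- enum 'I_k]>>%VS.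

End Filled.
End PipeDreams.

Section Duality.
Local Open Scope ring_scope.

Variable F : fieldType.

(** The rows of [A] are the coordinate vectors, with respect to [e], of a basis
    of [U]. *)
Definition realizes (vT : vectType F) (m n : nat) (e : n.-tuple vT)
    (A : 'M[F]_(m, n)) (U : {vspace vT}) : Prop :=
  basis_of U [seq \sum_(j < n) A i j *: tnth e j | i <- enum 'I_m].

Definition dual_space (vT : vectType F) : vectType F := 'Hom(vT, F^o).

Definition std_basis (n : nat) : n.-tuple 'rV[F]_n :=
  [tuple delta_mx 0 i | i < n].

Definition dual_basis (vT : vectType F) (n : nat) (e : n.-tuple vT) :
    n.-tuple (dual_space vT) :=
  [tuple linfun (coord e i : vT -> F^o) | i < n].

Section Annihilator.
Variables (vT : vectType F) (V : {vspace vT}).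

(** [f] vanishes on [V] iff its composite with a projection onto [V] is 0; see
    [annihilatorP]. *)
Definition precomp_proj (f : dual_space vT) : dual_space vT := (f \o projv V)%VF.

Lemma precomp_proj_is_linear : linear precomp_proj.
Proof.
by move=> a f g; rewrite /precomp_proj comp_lfunDl comp_lfunZl.
Qed.
HB.instance Definition _ :=
  GRing.isLinear.Build F (dual_space vT) (dual_space vT) _ precomp_proj
    precomp_proj_is_linear.

Definition annihilator : {vspace dual_space vT} := lker (linfun precomp_proj).

Lemma annihilatorP (f : 'Hom(vT, F^o)) :
  reflect (forall v, v \in V -> f v = 0) (f \in annihilator).
Proof.
rewrite /annihilator memv_ker lfunE; apply: (iffP eqP) => [fV0 v vV | fV0].
  by rewrite -(projv_id vV) -comp_lfunE -/(precomp_proj f) fV0 lfunE.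
by apply/lfunP => v; rewrite comp_lfunE lfunE /= fV0 // memv_proj.
Qed.

End Annihilator.
End Duality.

(* Main.v *)
Require Import Defs.
From HB Require Import structures.
From mathcomp Require Import all_boot all_order all_algebra.
From mathcomp Require Import reals.
From mathcomp Require Import zify.

Set Implicit Arguments.
Unset Strict Implicit.
Unset Printing Implicit Defensive.

Import GRing.Theory.

(** Cut the diagram along an antidiagonal staircase. A restricted path crosses
    each cut exactly once, so the path sums from the sources to the pipes
    crossing the cut form a square matrix M, indexed on both sides by pipes.
    Pushing the cut south-east across a cell whose two pipes are a < c
    multiplies M on the right by 1 + beta E_ca, since restricted paths may jump
    from c down to a; the dual path matrix is multiplied by 1 - beta E_ac, which
    is the inverse transpose of 1 + beta E_ca. At white cells both factors are 1.
    So the two full n x n path matrices, for parameters beta and - beta, are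
    inverse transposes of one another: rows with different sources are
    orthogonal, and rows with the same source have product 1. The row space of
    the restricted matrix comes from the sources on the west boundary, that of
    the dual one from the sources on the north boundary. Hence the latter
    annihilates the former, its rows are independent, and there are n - k of
    them, which is the dimension of the annihilator of V.

    The proof replaces the matrices by row vectors: to every edge is attached
    the vector of its path sums to all sinks ([path_vec]), which satisfies a
    recurrence over one cell ([path_vec_transfer]). Any two families of vectors
    satisfying such recurrences with coefficients related as above are dual
    bases along every cut ([transfer_duality]). The case of zero coefficients
    shows that different sources lie on different pipes ([pipe_inj]), so that
    the label of a source determines the edge at which a path starts
    ([path_sum_nw]). *)

(** * Edges of the diagram and their labels *)

(** Both sides say that the cell (r, c) lies in the Young diagram of [s], read
    by rows on the left and by columns on the right. *)
Lemma ltn_nth_count (s : seq nat) r c : sorted geq s ->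
  (c < nth 0 s r) = (r < count (fun x => c < x) s).
Proof.
elim: s r => [|x s IHs] r /=; first by rewrite nth_nil !ltn0.
move=> sx; have ss := path_sorted sx.
case: (ltnP c x) => [cx | xc].
  by case: r => [|r] /=; rewrite ?cx // add1n ltnS IHs.
have c0 : count (fun y => c < y) s = 0.
  apply/eqP; rewrite -leqn0 leqNgt -has_count; apply/hasP => -[y ys cy].
  have geq_tr : transitive geq by move=> u v t /= vu uz; apply: leq_trans vu.
  have /allP/(_ y ys)/= := order_path_min geq_tr sx; lia.
case: r => [|r] /=; first by rewrite c0 ltnNge xc.
by rewrite add0n IHs // c0.
Qed.

Lemma mem_map_cons (T : eqType) (x y : T) p s :
  (x :: p \in [seq y :: q | q <- s]) = (x == y) && (p \in s).
Proof.
by apply/mapP/andP => [[q qs [-> ->]] | [/eqP-> ps]]; [rewrite eqxx | exists p].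
Qed.

Section Edges.
Variables (k n : nat) (lam : k.-tuple nat) (D : filling k n).
Hypotheses (hkn : k <= n) (hlam : is_partition n lam).

Implicit Types (e : edge k n) (b : pos k n).

Lemma in_shapeE b : in_shape lam b = (b.1 < col_height lam b.2).
Proof. by case/andP: hlam => ls _; rewrite /in_shape ltn_nth_count. Qed.

Lemma leq_row r : nth 0 lam r <= n - k.
Proof.
case: (ltnP r k) => rk; last by rewrite nth_default ?size_tuple.
by case/andP: hlam => _ /all_nthP; apply; rewrite size_tuple.
Qed.

Lemma leq_col_height c : col_height lam c <= k.
Proof. by rewrite -[leqRHS](size_tuple lam) count_size. Qed.

Lemma in_shape_row b : in_shape lam b -> b.1 < k.
Proof. by rewrite in_shapeE => /leq_trans; apply; apply: leq_col_height. Qed.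

Lemma in_shape_col b : in_shape lam b -> b.2 < n - k.
Proof. by move=> /leq_trans; apply; apply: leq_row. Qed.

(** The edges that bound a cell or lie on a border, as opposed to the pairs of
    [edge] that only pad the index ranges. *)
Definition on_diagram e : bool :=
  match e with
  | (West, (r, c)) => (r < k) && (c <= nth 0 lam r)
  | (North, (r, c)) => (c < n - k) && (r <= col_height lam c)
  end.

(** Index of the antidiagonal through an edge: every step of a path raises it by
    one. *)
Definition level e : nat := e.2.1 + e.2.2.

Lemma level_ltn e : on_diagram e -> level e < n.
Proof.
case: e => -[] [r c] /= /andP[]; rewrite /level /=.
  by have := leq_row r; lia.
by have := leq_col_height c; lia.
Qed.

Lemma nw_on_diagram e : on_nw_border e -> on_diagram e.
Proof. by case: e => -[] [r c] /= /andP[-> /eqP->]. Qed.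

Lemma se_borderE e : on_se_border lam e = on_diagram e && ~~ in_shape lam e.2.
Proof.
case: e => -[] [r c] /=; rewrite -andbA; congr (_ && _).
  by rewrite /in_shape /= -leqNgt -eqn_leq.
by rewrite in_shapeE /= -leqNgt -eqn_leq.
Qed.

Lemma se_label_ltn e : on_se_border lam e -> se_label lam e < n.
Proof.
case: e => -[] [r c] /= /andP[].
  by have := leq_row r; lia.
by have := leq_col_height c; lia.
Qed.

Lemma row_length_anti r r' : r <= r' -> nth 0 lam r' <= nth 0 lam r.
Proof.
case/andP: hlam => ls _ rr'.
rewrite leqNgt (ltn_nth_count _ _ ls) -leqNgt.
by apply: leq_trans rr'; rewrite leqNgt -(ltn_nth_count _ _ ls) ltnn.
Qed.

Lemma col_height_anti c c' : c <= c' -> col_height lam c' <= col_height lam c.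
Proof. by move=> cc'; apply: sub_count => x /=; apply: leq_ltn_trans. Qed.

(** Along the border the labels strictly increase, by monotonicity of the row
    lengths and column heights. A vertical edge in row [r] and a horizontal one
    in column [c] have equal labels only if r + c + 1 is the row length plus the
    column height; but both are larger than c and r, respectively, if (r, c) is
    a cell, and neither is otherwise. *)
Lemma se_label_inj : {in on_se_border (n := n) lam &, injective (se_label lam)}.
Proof.
have mixed (r r' : 'I_k.+1) (c c' : 'I_(n - k).+1) :
    on_se_border lam (West, (r, c)) -> on_se_border lam (North, (r', c')) ->
    se_label lam (West, (r, c)) = se_label lam (North, (r', c')) -> False.
  move=> /andP[rk _] /andP[cn _] /=.
  have := in_shapeE (r, c'); rewrite /in_shape /=.
  by have := leq_row r; lia.
move=> [[] [r c]] [[] [r' c']]; rewrite !unfold_in.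
- move=> /andP[rk /eqP cE] /andP[rk' /eqP cE'] /= eq_lab.
  have rr' : r = r'.
    apply: val_inj => /=; have := leq_row r; have := leq_row r'.
    by case: (ltngtP r r') => // /[dup] lt_rr /ltnW/row_length_anti; lia.
  by have -> : c = c' by [apply: val_inj; rewrite /= cE cE' rr']; rewrite rr'.
- by move=> h h' /mixed-/(_ h h').
- by move=> h h' /esym/mixed-/(_ h' h).
move=> /andP[cn /eqP rE] /andP[cn' /eqP rE'] /= eq_lab.
have cc' : c = c'.
  apply: val_inj => /=.
  by case: (ltngtP c c') => // /[dup] lt_cc /ltnW/col_height_anti; lia.
by have -> : r = r' by [apply: val_inj; rewrite /= rE rE' cc']; rewrite cc'.
Qed.

(** The other edge by which paths enter the same cell. *)
Definition twin e : edge k n := (if e.1 is West then North else West, e.2).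

Lemma stay_twin e : stay D (twin e) = jump D e.
Proof. by case: e => -[] b; rewrite /stay /jump /=; case: (D b). Qed.

Lemma jump_twin e : jump D (twin e) = stay D e.
Proof. by case: e => -[] b; rewrite /stay /jump /=; case: (D b). Qed.

Lemma twin_neq e : twin e != e.
Proof. by case: e => -[] b. Qed.

Lemma same_cell e e' : e.2 = e'.2 -> e' = e \/ e' = twin e.
Proof. by case: e e' => [[] b] [[] b'] /= ->; auto. Qed.

Lemma stay_neq_jump e : stay D e != jump D e.
Proof. by case: e => -[] b; rewrite /stay /jump /=; case: (D b). Qed.

Lemma exits_ind (P : edge k n -> Prop) e :
  P (east e.2) -> P (south e.2) -> P (stay D e) /\ P (jump D e).
Proof. by case: e => -[] b; rewrite /stay /jump /=; case: (D b). Qed.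

(** * Antidiagonal cuts *)

Definition enters_next d o := [&& on_diagram o, level o == d.+1 & ~~ on_nw_border o].

Lemma enters_nextP e : in_shape lam e.2 ->
  enters_next (level e) (stay D e) /\ enters_next (level e) (jump D e).
Proof.
move: e => [s [r c]] /= eb; have := eb; rewrite in_shapeE /= => eb'.
have rk := in_shape_row eb; have cn := in_shape_col eb.
move: eb rk cn; rewrite /in_shape /= => eb rk cn.
apply: (exits_ind (P := enters_next _)); rewrite /enters_next /level /= !inordK ?ltnS //.
  by rewrite rk eb addnS eqxx.
by rewrite cn eb' addSn eqxx.
Qed.

(** An outgoing edge determines its cell: the one to the west of a vertical
    edge, to the north of a horizontal one. *)
Lemma cell_of_exit e e' : in_shape lam e.2 -> in_shape lam e'.2 ->
  stay D e = stay D e' \/ jump D e = jump D e' \/ stay D e = jump D e' ->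
  e.2 = e'.2.
Proof.
move=> eb eb'; have [rk cn] := (in_shape_row eb, in_shape_col eb).
have [rk' cn'] := (in_shape_row eb', in_shape_col eb').
have eE : east e.2 = east e'.2 -> e.2 = e'.2.
  case: (e.2) (e'.2) cn cn' => [r c] [r' c'] /= cn cn' [<-] /(congr1 val) /=.
  by rewrite !inordK ?ltnS // => -[] /val_inj ->.
have sE : south e.2 = south e'.2 -> e.2 = e'.2.
  case: (e.2) (e'.2) rk rk' => [r c] [r' c'] /= rk rk' [] /(congr1 val) /=.
  by rewrite !inordK ?ltnS // => -[] /val_inj -> ->.
by rewrite /stay /jump; case: (e.1) (e'.1) (D e.2) (D e'.2) => [] [] [] []
  [|[]] // /[dup] h ?; (apply: eE || apply: sE).
Qed.

(** The edges crossed by a staircase near the antidiagonal [d]: those on that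
    antidiagonal, the sinks that lie before it and the sources that lie beyond
    it. Every path crosses the cut once. All sources are in [cut 0] and all
    edges of [cut n] are sinks. *)
Definition cut d e :=
  [&& on_diagram e, (level e < d) ==> ~~ in_shape lam e.2
    & (d < level e) ==> on_nw_border e].

(** The edges that have to be moved across a cell to pass from the cut [d] to the
    next one. *)
Definition active d e := in_shape lam e.2 && (level e == d).

Lemma cutS_idle d e : cut d e -> ~~ active d e -> cut d.+1 e.
Proof.
rewrite /cut /active => /and3P[-> /implyP lo /implyP hi] /nandP na /=.
apply/andP; split; apply/implyP => lv; last by apply: hi; lia.
by case: na => // ne; apply: lo; lia.
Qed.

Lemma cutS_exit d o : enters_next d o -> cut d.+1 o.
Proof. by case/and3P=> od /eqP lo _; rewrite /cut od lo ltnn. Qed.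

Lemma exit_neq_idle d o e : enters_next d o -> cut d e -> (o == e) = false.
Proof.
case/and3P=> _ /eqP lo nw /and3P[_ _ /implyP hi].
by apply: contraNF nw => /eqP oe; rewrite oe in lo *; apply: hi; rewrite lo.
Qed.

Local Open Scope ring_scope.

(** * Duality of transfer recurrences *)

Section Transfer.
Variable F : fieldType.

(** The recurrence for path sums to the sinks when a jump of a path that enters
    a cell through [e] is weighted by [c e]. *)
Definition transfer (c : edge k n -> F) (f : edge k n -> 'rV[F]_n) : Prop :=
  (forall e, on_se_border lam e -> f e = \row_t (se_label lam e == t)%:R) /\
  (forall e, on_diagram e -> in_shape lam e.2 ->
     f e = f (stay D e) + c e *: f (jump D e)).

(** Descending induction over the cuts. On the last cut all edges are sinks,
    whose unit vectors are orthonormal. Moving the cut across a cell replaces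
    the two vectors of its outgoing edges by those of its incoming edges, which
    is the action of a 2 x 2 matrix on either family; the hypotheses on the
    coefficients say that the two matrices are inverse transposes. *)
Lemma transfer_duality (c c' : edge k n -> F) (f f' : edge k n -> 'rV[F]_n) :
  transfer c f -> transfer c' f' ->
  (forall e, c e * c' e = 0) -> (forall e, c' (twin e) = - c e) ->
  forall e e', on_nw_border e -> on_nw_border e' ->
    f e *m (f' e')^T = (e == e')%:R%:M.
Proof.
move=> [f_out f_in] [f'_out f'_in] cc' c'_twin.
suff cut_dual m d e e' : (m + d = n)%N -> cut d e -> cut d e' ->
    f e *m (f' e')^T = (e == e')%:R%:M.
  have cut0 e : on_nw_border e -> cut 0 e.
    by move=> nw; rewrite /cut nw_on_diagram //= nw implybT.
  by move=> e e' /cut0 ce /cut0 ce'; apply: (cut_dual n 0%N) => //; rewrite addn0.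
elim: m d e e' => [|m IHm] d e e' md ce ce'.
  have out o : cut d o -> on_se_border lam o.
    rewrite se_borderE => /and3P[oo /implyP lo _]; rewrite oo lo //.
    by rewrite -[d]add0n md level_ltn.
  have [eo eo'] := (out _ ce, out _ ce').
  rewrite f_out // f'_out //; apply/rowP => i; rewrite !mxE !ord1 /=.
  rewrite (bigD1 (Ordinal (se_label_ltn eo))) //= !mxE eqxx mul1r.
  rewrite big1 ?addr0 => [|t tne]; last first.
    rewrite !mxE (negbTE (_ : se_label lam e != t)) ?mul0r //.
    by apply: contraNneq tne => et; apply/eqP/val_inj.
  rewrite mulr1n; congr (_%:R); congr nat_of_bool.
  by apply/eqP/eqP => [/= /(se_label_inj eo' eo) | ee'] //=; rewrite ee'.
have {}IHm o o' : cut d.+1 o -> cut d.+1 o' -> f o *m (f' o')^T = (o == o')%:R%:M.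
  by apply: IHm; rewrite addnS.
have act o : cut d o -> active d o ->
    [/\ on_diagram o, enters_next d (stay D o) & enters_next d (jump D o)].
  move=> /and3P[oo _ _] /andP[ob /eqP <-]; have [] := enters_nextP ob.
  by split.
have split_l o u : cut d o -> active d o ->
    f o *m u = f (stay D o) *m u + c o *: (f (jump D o) *m u).
  move=> co ao; have [oo _ _] := act o co ao.
  by rewrite f_in ?mulmxDl ?scalemxAl //; case/andP: ao.
have split_r o u : cut d o -> active d o ->
    u *m (f' o)^T = u *m (f' (stay D o))^T + c' o *: (u *m (f' (jump D o))^T).
  move=> co ao; have [oo _ _] := act o co ao.
  rewrite f'_in //; last by case/andP: ao.
  by rewrite linearD linearZ /= mulmxDr scalemxAr.
have zeroM : (false%:R)%:M = 0 :> 'M[F]_1 by apply/rowP => i; rewrite !mxE mul0rn.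
case ae: (active d e); case ae': (active d e').
- have [eo es ej] := act e ce ae; have [eo' es' ej'] := act e' ce' ae'.
  have [/= eb _] := andP ae; have [/= eb' _] := andP ae'.
  rewrite (split_l _ e) // !(split_r _ e') //.
  rewrite !IHm ?(cutS_exit es) ?(cutS_exit ej) ?(cutS_exit es') ?(cutS_exit ej') //.
  have [cell | ncell] := eqVneq e.2 e'.2.
    (* The four products of outgoing edges are known by induction. For e' = e
       what remains is 1 + c e * c' e, and for e' = twin e it is c' e' + c e. *)
    have entries (x y z t z' u : F) : x + y * z + t * (z' + y * u) = (e == e')%:R ->
        x%:M + y *: z%:M + t *: (z'%:M + y *: u%:M) = (e == e')%:R%:M :> 'M[F]_1.
      by move=> <-; apply/rowP => i; rewrite !mxE !ord1 !mulr1n.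
    have [ee' | ee'] := same_cell cell; apply: entries; rewrite ee'.
      rewrite !eqxx (negPf (stay_neq_jump _)) eq_sym (negPf (stay_neq_jump _)).
      by rewrite !(mulr0, mulr1) add0r cc' !addr0.
    rewrite stay_twin jump_twin !eqxx (negPf (stay_neq_jump _)) eq_sym.
    rewrite (negPf (stay_neq_jump _)) eq_sym (negPf (twin_neq _)).
    by rewrite c'_twin !(mulr0, addr0, mulr1) add0r addNr.
  have exit_neq P : (P -> e.2 = e'.2) -> ~ P by move=> cellP /cellP; apply/eqP.
  have ss : (stay D e == stay D e') = false.
    by apply/eqP/exit_neq => h; apply: (cell_of_exit eb eb'); left.
  have jj : (jump D e == jump D e') = false.
    by apply/eqP/exit_neq => h; apply: (cell_of_exit eb eb'); right; left.
  have sj : (stay D e == jump D e') = false.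
    by apply/eqP/exit_neq => h; apply: (cell_of_exit eb eb'); right; right.
  have js : (jump D e == stay D e') = false.
    by apply/eqP/exit_neq => h; apply/esym/(cell_of_exit eb' eb); right; right.
  have -> : (e == e') = false by apply/eqP/exit_neq => ->.
  by rewrite ss jj sj js zeroM !(scaler0, addr0).
- have [eo es ej] := act e ce ae; have ne' := negbT ae'.
  rewrite (split_l _ e) // !IHm ?(cutS_exit es) ?(cutS_exit ej) ?cutS_idle //.
  rewrite (exit_neq_idle es ce') (exit_neq_idle ej ce') // zeroM scaler0 addr0.
  by case: eqP ae' => // <-; rewrite ae.
- have [eo' es' ej'] := act e' ce' ae'; have ne := negbT ae.
  rewrite (split_r _ e') // !IHm ?(cutS_exit es') ?(cutS_exit ej') ?cutS_idle //.
  rewrite !(eq_sym e) (exit_neq_idle es' ce) (exit_neq_idle ej' ce) // zeroM scaler0 addr0.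
  by case: eqP ae => // <-; rewrite ae'.
by rewrite IHm ?cutS_idle ?ae ?ae'.
Qed.

End Transfer.

Local Close Scope ring_scope.

(** * Pipes *)

Definition follow e := if in_shape lam e.2 then stay D e else e.

Lemma follow_fixed m e : ~~ in_shape lam e.2 -> iter m follow e = e.
Proof. by move=> /negPf ne; elim: m => //= m ->; rewrite /follow ne. Qed.

Lemma follow_in e : in_shape lam e.2 -> follow e = stay D e.
Proof. by rewrite /follow => ->. Qed.

(** Levels on the diagram are below [n], so a path cannot go on for longer. *)
Lemma follow_out m e : on_diagram e -> n <= (m + level e).+1 ->
  ~~ in_shape lam (iter m follow e).2.
Proof.
elim: m e => [|m IHm] e eo; rewrite ?add0n => lo.
  apply/negP => /= /enters_nextP[/and3P[so /eqP ls _] _].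
  by have := level_ltn so; lia.
have [eb | ne] := boolP (in_shape lam e.2); last by rewrite follow_fixed.
have [/and3P[so /eqP ls _] _] := enters_nextP eb.
by rewrite iterSr follow_in //; apply: IHm => //; lia.
Qed.

Lemma pipe_out e : on_se_border lam e -> pipe lam D e = se_label lam e.
Proof. by rewrite se_borderE /pipe => /andP[_ ne]; rewrite follow_fixed. Qed.

Lemma pipe_stay e : on_diagram e -> in_shape lam e.2 ->
  pipe lam D (stay D e) = pipe lam D e.
Proof.
move=> eo eb; rewrite /pipe; congr se_label.
have [/and3P[so /eqP ls _] _] := enters_nextP eb.
have n0 : 0 < n by have := level_ltn eo; lia.
have iter_n o : iter n follow o = iter n.-1.+1 follow o by rewrite prednK.
rewrite -/follow !iter_n [in RHS]iterSr follow_in // iterS.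
set last_e := iter _ _ _; have /negPf out : ~~ in_shape lam last_e.2.
  by apply: follow_out => //; lia.
by rewrite /follow out.
Qed.

(** The indicator vectors of the exit labels of the pipes satisfy the transfer
    recurrence without jumps. By duality they are orthonormal on the sources, so
    no two sources have the same vector. *)
Lemma pipe_inj : {in on_nw_border (n := n) (k := k) &, injective (pipe lam D)}.
Proof.
move=> e e' ne ne' eq_pipe; apply/eqP.
pose f (e : edge k n) : 'rV[rat]_n := (\row_t (pipe lam D e == t)%:R)%R.
have f_transfer : transfer (fun=> 0%R) f.
  split=> [o oo | o oo ob]; first by apply/rowP => t; rewrite !mxE pipe_out.
  by rewrite scale0r addr0; apply/rowP => t; rewrite !mxE pipe_stay.
have dual := @transfer_duality rat _ _ _ _ f_transfer f_transfer
  (fun=> mulr0 _)%R (fun=> esym (oppr0 _)).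
have ff : f e = f e' by apply/rowP => t; rewrite !mxE eq_pipe.
have := dual e e' ne ne'; rewrite -{}ff dual // eqxx => /matrixP/(_ ord0 ord0)/eqP.
by rewrite !mxE !mulr1n eq_sym; case: (e == e'); rewrite ?oner_eq0 // eq_sym oner_eq0.
Qed.

(** * Path sums satisfy the transfer recurrence *)

Section Routes.
Variable better : rel nat.

(** The paths with at most [m] edges that start at [e] and leave the diagram,
    listed by their first step so that sums over them unfold recursively. *)
Fixpoint routes m e : seq (seq (edge k n)) :=
  if m is m'.+1 then
    if in_shape lam e.2 then
      [seq e :: p | p <- routes m' (stay D e) ++
         (if may_jump lam D better e then routes m' (jump D e) else [::])]
    else [:: [:: e]]
  else [::].

Lemma mem_routes m e p : (p \in routes m e) =
  [&& size p <= m, 0 < size p, head e p == e,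
      path (path_step lam D better) e (behead p) & ~~ in_shape lam (last e p).2].
Proof.
elim: m e p => [|m IHm] e p; first by case: p.
rewrite /=; have [eb | ne] := boolP (in_shape lam e.2); last first.
  rewrite inE; case: p => [|o p] //=; rewrite eqseq_cons ltnS.
  have [-> | _] /= := eqVneq o e; rewrite ?andbF //.
  by case: p => [|x p] /=; rewrite ?ne // /path_step (negPf ne) /= andbF.
case: p => [|o p]; first by apply/mapP => -[].
rewrite mem_map_cons /= ltnS; have [-> | _] /= := eqVneq o e; rewrite ?andbF //.
rewrite mem_cat IHm; case: p => [|x p] /=.
  by rewrite !(eb, andbF); case: ifP => _; rewrite ?IHm ?andbF ?in_nil.
rewrite {2}/path_step eb /=; case: (may_jump _ _ _ _) => /=.
  rewrite IHm /=; have [-> | _] := eqVneq x (stay D e) => /=.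
    by rewrite (negPf (stay_neq_jump e)) /= !andbF orbF.
  by rewrite andbF /=; have [-> | _] := eqVneq x (jump D e) => /=; rewrite ?andbF.
by rewrite in_nil !orbF; have [-> | _] := eqVneq x (stay D e); rewrite ?andbF.
Qed.

Lemma routes_uniq m e : uniq (routes m e).
Proof.
elim: m e => [|m IHm] e //=; case: ifP => // _.
rewrite map_inj_uniq ?cat_uniq ?IHm /= => [|p q [] //].
case: ifP => //= _; rewrite IHm andbT; apply/hasPn => p; rewrite !mem_routes.
case: p => [|x p] /and5P[] //= _ _ /eqP-> _ _.
by rewrite eq_sym (negPf (stay_neq_jump _)) andbF.
Qed.

Lemma path_on_diagram e p : on_diagram e -> path (path_step lam D better) e p ->
  on_diagram (last e p) && (level (last e p) == level e + size p).
Proof.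
elim: p e => [|x p IHp] e eo /=; first by rewrite eo addn0 eqxx.
case/andP=> /andP[eb step] xp.
have [/and3P[so /eqP ls _] /and3P[jo /eqP lj _]] := enters_nextP eb.
case/orP: step => [/eqP xE | /andP[_ /eqP xE]]; rewrite {}xE in xp *.
  by rewrite addnS -addSn -ls IHp.
by rewrite addnS -addSn -lj IHp.
Qed.

Local Open Scope ring_scope.
Variables (F : fieldType) (beta : pos k n -> F).

Definition jump_coef e : F := if may_jump lam D better e then beta e.2 else 0.

(** A path from [e] runs through levels from [level e] to at most [n - 1], so
    the bound on its number of edges excludes none. *)
Definition path_vec e : 'rV[F]_n :=
  \sum_(p <- routes (n - level e) e)
     weight D beta p *: \row_t (se_label lam (last e p) == t)%:R.

Lemma weight_cons2 e x p : weight D beta [:: e, x & p] =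
  (if x == stay D e then 1 else beta e.2) * weight D beta (x :: p).
Proof.
rewrite /weight /jump_sites !big_map !big_filter [zip _ _]/= big_cons /=.
by case: eqP => //=; rewrite mul1r.
Qed.

Lemma path_vec_transfer : transfer jump_coef path_vec.
Proof.
split=> [e | e eo eb].
  rewrite se_borderE /path_vec => /andP[eo /negPf ne].
  have -> : (n - level e = (n - level e).-1.+1)%N by have := level_ltn eo; lia.
  by rewrite /= ne big_seq1 /weight /jump_sites big_nil scale1r.
have [/and3P[_ /eqP ls _] /and3P[_ /eqP lj _]] := enters_nextP eb.
rewrite /path_vec ls lj.
have -> : (n - level e = (n - (level e).+1).+1)%N by have := level_ltn eo; lia.
rewrite /= eb big_map big_cat /= /jump_coef; congr (_ + _).
  rewrite !big_seq; apply: eq_bigr => -[|x p]; rewrite mem_routes // => /and5P[] //.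
  by move=> _ _ /eqP /= -> _ _; rewrite weight_cons2 eqxx mul1r.
case: ifP => _; last by rewrite big_nil scale0r.
rewrite scaler_sumr !big_seq; apply: eq_bigr => -[|x p]; rewrite mem_routes //.
move=> /and5P[] // _ _ /eqP /= -> _ _.
by rewrite weight_cons2 eq_sym (negPf (stay_neq_jump _)) scalerA.
Qed.

(** A path is only required to start at some source labelled with the given
    pipe; by [pipe_inj] that source is [e]. *)
Lemma path_sum_nw e (t : 'I_n) : on_nw_border e ->
  path_sum lam D better beta (pipe lam D e) t = path_vec e 0 t.
Proof.
move=> nw; have eo := nw_on_diagram nw.
rewrite /path_vec summxE.
under eq_bigr => p _ do rewrite !mxE mulr_natr mulrb.
rewrite -big_mkcond -big_filter /path_sum.
set P := fun p : n.-bseq (edge k n) => is_path lam D better (pipe lam D e) t p.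
have -> : \sum_(p | P p) weight D beta p =
    \sum_(p <- map val (enum P)) weight D beta p by rewrite big_map big_enum.
apply/perm_big/uniq_perm.
- by rewrite map_inj_uniq ?enum_uniq //; apply: val_inj.
- by rewrite filter_uniq ?routes_uniq.
move=> p; rewrite mem_filter mem_routes.
have -> : (p \in map val (enum P)) =
    (size p <= n)%N && is_path lam D better (pipe lam D e) t p.
  apply/mapP/andP => [[q] | [pn pP]].
    by rewrite mem_enum => qP ->; split=> //; apply: size_bseq.
  by exists (Bseq pn); rewrite ?mem_enum.
case: p => [|o p] /=; first by rewrite !andbF.
have [-> | oe] /= := eqVneq o e; last first.
  rewrite !andbF; apply/negP => /andP[_ /and3P[nwo /eqP/(pipe_inj nwo nw) oE _]].
  by rewrite oE eqxx in oe.
rewrite nw eqxx /=; case ep: (path _ e p); last by rewrite !andbF.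
have /andP[lo /eqP ll] := path_on_diagram eo ep.
have := level_ltn lo; rewrite ll => lt_n.
rewrite se_borderE lo /= andbA.
have -> : (size p < n)%N by apply: leq_ltn_trans lt_n; apply: leq_addl.
have -> : (size p < n - level e)%N by rewrite ltn_subRL.
by rewrite andbC.
Qed.

End Routes.

Local Open Scope ring_scope.

(** At a cell a restricted jump from one entry is possible exactly if a dual
    restricted jump from the other entry is, because the two entries exchange
    the pipe kept and the pipe jumped to; from the same entry at most one of the
    two jumps goes to a pipe of the right kind. *)
Lemma path_vec_duality (F : fieldType) (beta : pos k n -> F) e e' :
  on_nw_border e -> on_nw_border e' ->
  path_vec ltn beta e *m (path_vec gtn (fun b => - beta b) e')^T = (e == e')%:R%:M.
Proof.
apply: transfer_duality; [exact: path_vec_transfer .. | |] => o; rewrite /jump_coef.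
  have [lt_o | _] := ifPn; last by rewrite mul0r.
  have [gt_o | _] := ifPn; last by rewrite mulr0.
  move: lt_o gt_o; rewrite /may_jump; case: symbol => //=;
    by move=> lt_o /(ltn_trans lt_o); rewrite ltnn.
have -> : may_jump lam D gtn (twin o) = may_jump lam D ltn o.
  by rewrite /may_jump stay_twin jump_twin.
by case: ifP; rewrite ?oppr0.
Qed.

End Edges.

Local Open Scope ring_scope.

(** * Realizing the annihilator *)

Lemma map_enum_mktuple (T : Type) n (f : 'I_n -> T) :
  [seq f i | i <- enum 'I_n] = [tuple f i | i < n].
Proof. by rewrite -val_ord_tuple. Qed.

(** The annihilator is the kernel of precomposition with the projection onto
    [V], and the image of the latter contains the independent functionals that
    extend the coordinate functions of a basis of [V]. *)
Lemma leq_dim_annihilator (F : fieldType) (vT : vectType F) (V : {vspace vT}) :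
  (\dim (annihilator V) + \dim V <= dim vT)%N.
Proof.
pose pr := linfun (@precomp_proj F vT V).
pose X := [tuple precomp_proj V (linfun (coord (vbasis V) i : vT -> F^o)) | i < \dim V].
have freeX : free X.
  apply/freeP => x; under eq_bigr => i _ do rewrite nth_mktuple.
  move=> /lfunP sum0 i; have := sum0 (vbasis V)`_i.
  have Vi : (vbasis V)`_i \in V by rewrite vbasis_mem ?mem_nth ?size_tuple.
  rewrite sum_lfunE lfunE /= => <-.
  rewrite (bigD1 i) //= big1 => [|j ji]; rewrite scale_lfunE comp_lfunE projv_id //;
    rewrite lfunE /= coord_free ?(basis_free (vbasisP V)) //.
    by rewrite eqxx addr0; apply: esym (mulr1 _).
  by rewrite eq_sym (negPf ji) scaler0.
have sub_img : (<<X>> <= limg pr)%VS.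
  apply/span_subvP => _ /mapP[i _ ->].
  by rewrite -[precomp_proj _ _]/(@precomp_proj F vT V _) -lfunE memv_img ?memvf.
have := limg_ker_dim pr fullv; rewrite capfv dimvf => dims.
have dim_hom : dim (dual_space vT) = dim vT by rewrite /dim /= muln1.
rewrite -{}dim_hom -dims leq_add2l (leq_trans _ (dimvS sub_img)) //.
by move: freeX; rewrite /free size_tuple => /eqP->.
Qed.

Section StandardBasis.
Variables (F : fieldType) (n : nat).

Lemma std_basis_sum (k : 'I_n -> F) :
  \sum_(i < n) k i *: (std_basis F n)`_i = \row_i k i.
Proof.
rewrite [RHS]row_sum_delta; apply: eq_bigr => i _.
by rewrite mxE -tnth_nth tnth_mktuple.
Qed.

Lemma coord_std_basis (v : 'rV[F]_n) i : coord (std_basis F n) i v = v 0 i.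
Proof.
have free_std : free (std_basis F n).
  by apply/freeP => k; rewrite std_basis_sum => /rowP k0 j; have := k0 j; rewrite !mxE.
have {1}-> : v = \sum_(j < n) v 0 j *: (std_basis F n)`_j.
  by rewrite std_basis_sum; apply/rowP => j; rewrite mxE.
by rewrite coord_sum_free.
Qed.

Definition row_functional (u : 'rV[F]_n) : dual_space 'rV[F]_n :=
  \sum_(j < n) u 0 j *: tnth (dual_basis (std_basis F n)) j.

Lemma row_functionalE u v : row_functional u v = (u *m v^T) 0 0.
Proof.
rewrite sum_lfunE mxE; apply: eq_bigr => j _.
by rewrite scale_lfunE tnth_mktuple lfunE /= coord_std_basis mxE.
Qed.

(** The rows of [B] give independent functionals vanishing on [V], and their
    number is the codimension of [V]. *)
Lemma realizes_annihilator k l (A : 'M[F]_(k, n)) (B : 'M[F]_(l, n))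
    (V : {vspace 'rV[F]_n}) :
  (k + l = n)%N -> realizes (std_basis F n) A V ->
  row_free B -> B *m A^T = 0 ->
  realizes (dual_basis (std_basis F n)) B (annihilator V).
Proof.
move=> kln VA /row_freeP[C BC] BA.
have rowsB : [seq \sum_(j < n) B i j *: tnth (dual_basis (std_basis F n)) j
             | i <- enum 'I_l] = [tuple row_functional (row i B) | i < l].
  rewrite -map_enum_mktuple; apply: eq_map => i.
  by apply: eq_bigr => j _; rewrite mxE.
have rowsA : [seq \sum_(j < n) A i j *: tnth (std_basis F n) j | i <- enum 'I_k]
             = [seq row i A | i <- enum 'I_k].
  apply: eq_map => i; under eq_bigr => j _ do rewrite (tnth_nth 0).
  by rewrite std_basis_sum; apply/rowP => j; rewrite !mxE.
move: VA; rewrite /realizes rowsA rowsB map_enum_mktuple => VA.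
rewrite basisEfree; apply/and3P; split.
- apply/freeP => x; under eq_bigr => i _ do rewrite nth_mktuple.
  (* The columns of a right inverse [C] of [B] form a dual family of vectors. *)
  move=> /lfunP sum0 i; have := sum0 (row i C^T).
  rewrite sum_lfunE lfunE /= => <-; rewrite (bigD1 i) //= big1 => [|j ji].
    rewrite addr0 scale_lfunE row_functionalE.
    have -> : (row i B *m (row i C^T)^T) 0 0 = (B *m C) i i.
      by rewrite !mxE; apply: eq_bigr => j _; rewrite !mxE.
    by rewrite BC mxE eqxx; apply: esym (mulr1 _).
  rewrite scale_lfunE row_functionalE.
  have -> : (row j B *m (row i C^T)^T) 0 0 = (B *m C) j i.
    by rewrite !mxE; apply: eq_bigr => t _; rewrite !mxE.
  by rewrite BC mxE (negPf ji) scaler0.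
- apply/span_subvP => f /= /mapP[i _ ->]; apply/annihilatorP.
  suff: (V <= lker (row_functional (row i B)))%VS.
    by move=> /subvP sub v /sub; rewrite memv_ker => /eqP.
  rewrite -(span_basis VA); apply/span_subvP => _ /mapP[j _ ->].
  rewrite memv_ker row_functionalE; apply/eqP.
  have /matrixP/(_ i j) := BA; rewrite !mxE => {2}<-.
  by apply: eq_bigr => t _; rewrite !mxE.
rewrite size_tuple -(leq_add2r k) addnC -{1}(size_basis VA) addnC [leqRHS]addnC kln.
by apply: leq_trans (leq_dim_annihilator V) _; rewrite dim_matrix mul1r.
Qed.

End StandardBasis.

Theorem theorem3p21 (R : realType) (F : fieldType) (hF : real_or_complex R F)
    (k n : nat) (hkn : (k <= n)%N)
    (V : {vspace 'rV[F]_n}) (hV : \dim V = k)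
    (lam : k.-tuple nat) (hlam : is_partition n lam)
    (D : filling k n) (hD : Go_diagram lam D)
    (w : seq (pos k n)) (hw : reading_word lam w)
    (hVD : in_Deodhar lam D hkn w V)
    (beta : pos k n -> F) (hbeta : jump_parameters lam D beta)
    (hR : realizes (std_basis F n) (restricted_mx lam D beta) V) :
  realizes (dual_basis (std_basis F n))
    (dual_restricted_mx lam D (fun b => - beta b)) (annihilator V).
Proof.
pose west (i : 'I_k) : edge k n := (West, (inord i, ord0)).
pose north (i : 'I_(n - k)) : edge k n := (North, (ord0, inord (n - k - i.+1)%N)).
have west_nw i : on_nw_border (west i).
  by have ik := ltn_ord i; rewrite /= inordK ?ik ?eqxx // ltnS ltnW.
have north_val (i : 'I_(n - k)) :
    (inord (n - k - i.+1) : 'I_(n - k).+1) = (n - k - i.+1)%N :> nat.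
  by rewrite inordK // ltnS leq_subr.
have north_nw i : on_nw_border (north i).
  by rewrite /= north_val eqxx andbT; have := ltn_ord i; lia.
have north_inj : injective north.
  move=> i j [] /(congr1 val) /=; rewrite !north_val => eq_ij; apply: val_inj => /=.
  by have := ltn_ord i; have := ltn_ord j; lia.
set B := dual_restricted_mx _ _ _.
pose p e := path_vec lam D ltn beta e.
pose p' e := path_vec lam D gtn (fun b => - beta b) e.
have BE i t : B i t = p' (north i) 0 t.
  rewrite mxE; exact: path_sum_nw (north_nw i).
have AE i t : restricted_mx lam D beta i t = p (west i) 0 t.
  rewrite mxE; exact: path_sum_nw (west_nw i).
have dual e i : on_nw_border e ->
    \sum_t B i t * p e 0 t = (e == north i)%:R.
  move=> nw; have /matrixP/(_ 0 0) := path_vec_duality D hkn hlam beta nw (north_nw i).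
  rewrite !mxE mulr1n => <-; apply: eq_bigr => t _.
  by rewrite BE mulrC [_^T _ _]mxE.
apply: (realizes_annihilator _ hR); first exact: subnKC.
  (* The restricted path sums from the north sources give a right inverse. *)
  apply/row_freeP; exists (\matrix_(t, i) p (north i) 0 t).
  apply/matrixP => i j; rewrite !mxE.
  under eq_bigr => t _ do rewrite [_ t j]mxE.
  by rewrite dual // (inj_eq north_inj) eq_sym.
apply/matrixP => i j; rewrite !mxE.
under eq_bigr => t _ do rewrite [_^T _ _]mxE AE.
by rewrite dual.
Qed.
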